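(* Let $\mathcal{H}$ be a real Hilbert space, let $\alpha,\beta\in\mathbb{R}$ with $\alpha+\beta\ge 0$, and let $A,B:\mathcal{H}\rightrightarrows\mathcal{H}$ be maximally $\alpha$-monotone and maximally $\beta$-monotone, respectively, with $\operatorname{zer}(A+B)\ne\varnothing$. Let $(\gamma,\delta,\lambda,\mu)\in\mathbb{R}_{++}^4$ satisfy $$(\lambda-1)(\mu-1)=1\quad\text{and}\quad\delta=(\lambda-1)\gamma,$$ and suppose that $$\begin{cases}\delta(1+2\gamma\alpha)=\gamma, & \text{if }\alpha+\beta=0,\\ (\gamma+\delta)^2<4\gamma\delta(1+\gamma\alpha)(1+\delta\beta), & \text{if }\alpha+\beta>0.\end{cases}$$ Let $\kappa\in\left]0,\overline{\kappa}\right[$, where $$\overline{\kappa}:=\begin{cases}1, & \text{if }\alpha+\beta=0,\\ \dfrac{4\gamma\delta(1+\gamma\alpha)(1+\delta\beta)-(\gamma+\delta)^2}{2\gamma\delta(\gamma+\delta)(\alpha+\beta)}, & \text{if }\alpha+\beta>0.\end{cases}$$ Let $x_0\in\mathcal{H}$ be an arbitrary starting point and let $(x_k)_{k=0}^{\infty}$ be generated by $x_{k+1}=T_{\mathrm{aDR}}(x_k)$, $k=0,1,2,\ldots$, where $T_{\mathrm{aDR}}$ is the adaptive Douglas--Rachford operator associated with $A,B,\gamma,\delta,\lambda,\mu,\kappa$, and let $J_1=J_{\gamma A}$. Then the shadow sequence $(J_1(x_k))_{k=0}^{\infty}$ converges weakly: $$J_1(x_k)\rightharpoonup J_1(x^\star)\in\operatorname{zer}(A+B),$$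 where $x^\star\in\operatorname{Fix}T_{\mathrm{aDR}}$ is the weak limit of $(x_k)_{k=0}^{\infty}$.
   Context: $\mathbb{R}_{++}=\{r\in\mathbb{R}:r>0\}$; $\rightharpoonup$ denotes weak convergence; $\operatorname{Id}$ is the identity on $\mathcal{H}$. For a set-valued operator $A:\mathcal{H}\rightrightarrows\mathcal{H}$: $\operatorname{gra}A=\{(x,u):u\in A(x)\}$, $\operatorname{zer}A=\{x:0\in A(x)\}$, $\operatorname{Fix}A=\{x:x\in A(x)\}$. For $\alpha\in\mathbb{R}$, $A$ is $\alpha$-monotone if $\langle x-y,u-v\rangle\ge\alpha\|x-y\|^2$ for all $(x,u),(y,v)\in\operatorname{gra}A$; it is maximally $\alpha$-monotone if moreover there is no $\alpha$-monotone operator whose graph properly contains $\operatorname{gra}A$. The resolvent of $A$ is $J_A:=(\operatorname{Id}+A)^{-1}$. Given $(\gamma,\delta,\lambda,\mu,\kappa)\in\mathbb{R}_{++}^5$, set $$J_1:=J_{\gamma A},\quad R_1:=(1-\lambda)\operatorname{Id}+\lambda J_1,\quad J_2:=J_{\delta B},\quad R_2:=(1-\mu)\operatorname{Id}+\mu J_2.$$ The adaptive Douglas--Rachford operator is $T_{\mathrm{aDR}}:=(1-\kappa)\operatorname{Id}+\kappa R_2R_1$. Under the hypotheses of the claim, it is known that $1+\gamma\alpha>0$ and $1+\delta\beta>0$, that $J_1$ and $J_2$ (hence $T_{\mathrm{aDR}}$) are single-valued with full domain $\mathcal{H}$, and that $(x_k)$ converges weakly to a point $x^\star\in\operatorname{Fix}T_{\mathrm{aDR}}$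 with $J_1(x^\star)\in\operatorname{zer}(A+B)$; this $x^\star$ is the one in the claim. *)

(* Defs.v *)
From HB Require Import structures.
From mathcomp Require Import all_boot all_order all_algebra sesquilinear.
From mathcomp Require Import all_classical all_reals topology normedtype.

Set Implicit Arguments.
Unset Strict Implicit.
Unset Printing Implicit Defensive.

Import Order.TTheory GRing.Theory Num.Theory.
Import numFieldNormedType.Exports.

Local Open Scope classical_set_scope.
Local Open Scope ring_scope.

(* A set-valued operator on H is a map A : H -> set H.  A single-valued one,
   given by T : H -> H, is identified with sv_op T. *)

Definition sv_op (H : Type) (T : H -> H) : H -> set H := fun x => [set T x].

Definition gra (H : Type) (A : H -> set H) : set (H * H) :=
  [set xu | A xu.1 xu.2].

Definition zer (H : zmodType) (A : H -> set H) : set H := [set x | A x 0].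

Definition Fix (H : Type) (A : H -> set H) : set H := [set x | A x x].

Definition add_op (H : zmodType) (A B : H -> set H) : H -> set H :=
  fun x => [set u + v | u in A x & v in B x].

Definition scale_op (R : pzRingType) (H : lmodType R) (c : R) (A : H -> set H) :
    H -> set H :=
  fun x => [set c *: u | u in A x].

Definition inv_op (H : Type) (A : H -> set H) : H -> set H :=
  fun u => [set x | A x u].

Definition resolvent_op (H : zmodType) (A : H -> set H) : H -> set H :=
  inv_op (add_op (sv_op id) A).

(* The resolvent as a map: the selection is the unique element of
   resolvent_op A x whenever that set is a singleton, which for the operators
   of interest follows from maximality (Minty's theorem); the default value x
   is returned only when that set is empty. *)
Definition resolvent (H : zmodType) (A : H -> set H) : H -> H :=
  fun_of_rel id (resolvent_op A).

Definition relax (R : pzRingType) (H : lmodType R) (c : R) (J : H -> H) :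
    H -> H :=
  fun x => (1 - c) *: x + c *: J x.

Definition aDR (R : pzRingType) (H : lmodType R) (A B : H -> set H)
    (gamma delta lambda mu kappa : R) : H -> H :=
  let R1 := relax lambda (resolvent (scale_op gamma A)) in
  let R2 := relax mu (resolvent (scale_op delta B)) in
  relax kappa (R2 \o R1).

Definition alpha_monotone (R : realType) (H : normedModType R)
    (dot : {dot H for idfun}) (alpha : R) (A : H -> set H) : Prop :=
  forall x u y v, gra A (x, u) -> gra A (y, v) ->
    alpha * `|x - y| ^+ 2 <= dot (x - y) (u - v).

Definition maximally_alpha_monotone (R : realType) (H : normedModType R)
    (dot : {dot H for idfun}) (alpha : R) (A : H -> set H) : Prop :=
  alpha_monotone dot alpha A /\
  ~ exists A' : H -> set H, alpha_monotone dot alpha A' /\ gra A `<` gra A'.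

(* Convergence in the weak topology of a Hilbert space, the initial topology
   for the functionals z |-> dot z y. *)
Definition weak_cvg (R : realType) (H : normedModType R)
    (dot : {dot H for idfun}) (x : nat -> H) (l : H) : Prop :=
  forall y : H, dot (x k) y @[k --> \oo] --> dot l y.

Definition kappa_bar (R : realType) (alpha beta gamma delta : R) : R :=
  if alpha + beta == 0 then 1 else
    (4 * gamma * delta * (1 + gamma * alpha) * (1 + delta * beta)
       - (gamma + delta) ^+ 2)
    / (2 * gamma * delta * (gamma + delta) * (alpha + beta)).

(* Main.v *)
(* With y_k = J1 x_k, z_k = J2 (R1 x_k) and w_k = y_k - z_k one has
   T x_k = x_k - kappa mu w_k.  Adding the two (weak or strong) monotonicity
   inequalities gives c |w_k|^2 <= <w_k, x_k - p> with 2 c > kappa mu for every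
   p = y + gamma b such that b \in A y and - b \in B y, so (x_k) is Fejer
   monotone with respect to these points and w_k --> 0.  The same sum of
   inequalities passes to the limit along any ultrafilter on the indices: if
   x_k and y_k converge weakly to l and y, then a = (l - y) / gamma satisfies
   a \in A y and - a \in B y, i.e. y = J1 l.  Opial's argument makes l
   independent of the ultrafilter, hence so is y = J1 l, and both sequences
   converge weakly.  Riesz's theorem and Minty's surjectivity theorem are both
   obtained by minimising a strongly convex function, whose minimising sequences
   are Cauchy. *)

Require Import Defs.
From HB Require Import structures.
From mathcomp Require Import all_boot all_order all_algebra sesquilinear.
From mathcomp Require Import all_classical all_reals topology normedtype.
From mathcomp Require Import sequences.
From mathcomp Require Import ring lra.

Import Order.TTheory GRing.Theory Num.Theory.
Import numFieldNormedType.Exports.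

Local Open Scope classical_set_scope.
Local Open Scope ring_scope.

(** * Minimising sequences of strongly convex functions *)

Section Minimization.
Context {R : realType}.

Lemma ex_minimizing_seq (T : Type) (g : T -> R) (t0 : T) (b : R) :
  (forall t, b <= g t) ->
  exists (m : R) (p : nat -> T),
    (forall t, m <= g t) /\ g (p n) @[n --> \oo] --> m.
Proof.
move=> gb; pose E := range g.
have hE : has_inf E.
  by split; [exists (g t0), t0 | exists b => _ [t _ <-]].
have near_inf (n : nat) : exists t, g t < inf E + n.+1%:R^-1.
  have [|_ [t _ <-] lt_t] := inf_adherent (eps := n.+1%:R^-1) _ hE.
    by rewrite invr_gt0 ltr0n.
  by exists t.
have [p p_lt] := choice near_inf.
have inf_le t : inf E <= g t by apply: ge_inf; [case: hE | exists t].
exists (inf E), p; split => //.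
apply: (@squeeze_cvgr _ _ _ _ (fun=> inf E) (fun n => inf E + n.+1%:R^-1)).
- by near=> n; rewrite inf_le ltW.
- exact: cvg_cst.
- rewrite -[X in _ --> X]addr0.
  by apply: cvgD; [exact: cvg_cst | exact: cvg_harmonic].
Unshelve. all: by end_near. Qed.

(** Since [m <= g r], the midpoint inequality bounds [|h s - h t|^2] by [4 (g s + g t - 2 m)], which
    makes the image sequence Cauchy. The map [h] allows one component of a minimising sequence to be
    treated at a time. *)
Lemma minimizing_seq_cvg (V : completeNormedModType R) (T : Type) (g : T -> R)
    (h : T -> V) (p : nat -> T) (m : R) :
  (forall t, m <= g t) ->
  (forall s t, exists r, g r <= (g s + g t) / 2 - `|h s - h t| ^+ 2 / 8) ->
  g (p n) @[n --> \oo] --> m -> cvg (h (p n) @[n --> \oo]).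
Proof.
move=> m_le mid gm; apply: cauchy_cvg; apply: cauchy_exP => e e_gt0.
have e8 : 0 < e ^+ 2 / 8 by rewrite divr_gt0 ?exprn_gt0.
have := cvgr_lt _ gm (m + e ^+ 2 / 8); rewrite ltrDl => /(_ _ e8).
move=> [N _ Nlt]; exists (h (p N)); exists N => // n /= Nn.
rewrite -ball_normE /=.
have [r r_le] := mid (p N) (p n).
have ltN := Nlt N (leqnn N); have ltn := Nlt n Nn; have mr := m_le r.
rewrite /= in ltN ltn.
rewrite -(ltr_pXn2r (n := 2)) ?nnegrE ?normr_ge0 ?(ltW e_gt0) //.
by lra.
Qed.

End Minimization.

(** * Inner products, Minty's theorem and Riesz's theorem *)

Section InnerProduct.
Context {R : realType} {H : completeNormedModType R} (dot : {dot H for idfun}).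
Context (dot_norm : forall z : H, dot z z = `|z| ^+ 2).

Lemma dotC u v : dot u v = dot v u.
Proof. by rewrite hermC /= expr0 mul1r. Qed.

Lemma dotDl u v w : dot (u + v) w = dot u w + dot v w.
Proof. exact: linearDl. Qed.

Lemma dotDr u v w : dot u (v + w) = dot u v + dot u w.
Proof. exact: linearDr. Qed.

Lemma dotNl u v : dot (- u) v = - dot u v.
Proof. exact: linearNl. Qed.

Lemma dotNr u v : dot u (- v) = - dot u v.
Proof. exact: linearNr. Qed.

Lemma dotZl c u v : dot (c *: u) v = c * dot u v.
Proof. exact: linearZl_LR. Qed.

Lemma dotZr c u v : dot u (c *: v) = c * dot u v.
Proof. exact: linearZr_LR. Qed.

Lemma dot0l u : dot 0 u = 0.
Proof. exact: linear0l. Qed.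

Lemma dot0r u : dot u 0 = 0.
Proof. exact: linear0r. Qed.

Definition dotE := (dotDl, dotDr, dotNl, dotNr, dotZl, dotZr).

Lemma dot_ge0 u : 0 <= dot u u.
Proof. by rewrite dot_norm exprn_ge0. Qed.

Lemma dot_eq0 u : dot u u <= 0 -> u = 0.
Proof.
rewrite dot_norm => u_le0; apply/normr0_eq0/eqP.
by rewrite -sqrf_eq0 eq_le u_le0 exprn_ge0.
Qed.

Lemma CauchySchwarz u v : `|dot u v| <= `|u| * `|v|.
Proof.
have [->|v0] := eqVneq v 0.
  by rewrite dot0r !normr0 mulr0.
have dv : 0 < dot v v by rewrite dot_norm exprn_gt0 // normr_gt0.
rewrite -(ler_pXn2r (n := 2)) ?nnegrE ?mulr_ge0 //.
rewrite exprMn -!dot_norm real_normK ?num_real //.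
have := dot_ge0 (dot v v *: u - dot u v *: v).
rewrite !dotE (dotC v u) => ge0.
rewrite -(ler_pM2l dv) -subr_ge0; apply: le_trans ge0 _.
by rewrite le_eqVlt; apply/orP; left; apply/eqP; ring.
Qed.

Lemma cvg_dotl (x : nat -> H) l w :
  x n @[n --> \oo] --> l -> dot (x n) w @[n --> \oo] --> dot l w.
Proof.
move=> xl; apply/cvgrPdist_lt => e e0.
have w1 : 0 < `|w| + 1 by rewrite ltr_wpDl.
have d0 : 0 < e / (`|w| + 1) by rewrite divr_gt0.
have /cvgrPdist_lt/(_ _ d0) := xl.
apply: filterS => n; rewrite ltr_pdivlMr // => lt_n.
rewrite -dotNl -dotDl; apply: le_lt_trans (CauchySchwarz _ _) _.
apply: le_lt_trans lt_n; apply: ler_wpM2l => //.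
by rewrite lerDl.
Qed.

(* With [Q] the symmetric form s + s' - <y, v'> - <y', v>, the set [G] is the
   polar of the graph of [M] (the epigraph of its Fitzpatrick function) and [S]
   its bipolar, a closed convex set containing the graph on which <y, v> <= s.
   If (y, v, s) minimises s + (|y|^2 + |v|^2) / 2 on [S], the first-order
   condition says that (- v, - y) is monotonically related to [M]. *)
Lemma minty (M : H -> H -> Prop) :
  (exists x u, M x u) ->
  (forall x u y v, M x u -> M y v -> 0 <= dot (x - y) (u - v)) ->
  (forall y v, (forall x u, M x u -> 0 <= dot (x - y) (u - v)) -> M y v) ->
  exists x, M x (- x).
Proof.
move=> [x0 [u0 M0]] mono maxi.
pose Q (y v : H) (s : R) (y' v' : H) (s' : R) :=
  s + s' - dot y v' - dot y' v.
pose G y v s := forall x u, M x u -> 0 <= Q x u (dot x u) y v s.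
pose S y v s := forall y' v' s', G y' v' s' -> 0 <= Q y v s y' v' s'.
have MG x u : M x u -> G x u (dot x u).
  move=> Mxu y v Myv; have := mono _ _ _ _ Mxu Myv.
  by rewrite /Q !dotE; lra.
have MS x u : M x u -> S x u (dot x u).
  by move=> Mxu y v s Gyvs; exact: Gyvs.
(* The graph lies in [G], so a point of [S] is also in [G]; pairing it with itself gives
   [0 <= 2 (s - dot y v)]. *)
have S_ge y v s : S y v s -> dot y v <= s.
  move=> Syvs; suff /Syvs : G y v s by rewrite /Q; lra.
  by move=> x u /MG/Syvs; rewrite /Q; lra.
have Sconv t y v s y' v' s' : 0 <= t -> t <= 1 -> S y v s -> S y' v' s' ->
    S (y + t *: (y' - y)) (v + t *: (v' - v)) (s + t * (s' - s)).
  move=> t0 t1 S1 S2 z w r Gr; have := S1 _ _ _ Gr; have := S2 _ _ _ Gr.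
  rewrite /Q !dotE => h2 h1.
  have := mulr_ge0 t0 h2; have : 0 <= 1 - t by lra.
  by move=> /mulr_ge0/(_ h1); lra.
pose T := {p : H * H * R | S p.1.1 p.1.2 p.2}.
pose mkT y v s (Sp : S y v s) : T := exist _ (y, v, s) Sp.
pose fy (p : T) : H := (sval p).1.1.
pose fv (p : T) : H := (sval p).1.2.
pose fs (p : T) : R := (sval p).2.
pose gg y v s : R := s + (dot y y + dot v v) / 2.
pose g (p : T) := gg (fy p) (fv p) (fs p).
have TS (p : T) : S (fy p) (fv p) (fs p) by exact: (proj2_sig p).
(* As [dot y v <= s] on [S], [gg y v s] is at least half of [|y + v|^2]. *)
have g_ge0 p : 0 <= g p.
  have := S_ge _ _ _ (TS p); have := dot_ge0 (fy p + fv p).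
  by rewrite /g /gg !dotE (dotC (fv p)); lra.
have [m [p [m_le gm]]] :=
  ex_minimizing_seq _ g (mkT _ _ _ (MS _ _ M0)) 0 g_ge0.
have mid (a b : T) : exists c, g c <=
    (g a + g b) / 2 - (dot (fy a - fy b) (fy a - fy b)
      + dot (fv a - fv b) (fv a - fv b)) / 8.
  have h0 : 0 <= 1 / 2 :> R by lra.
  have h1 : 1 / 2 <= 1 :> R by lra.
  exists (mkT _ _ _ (Sconv _ _ _ _ _ _ _ h0 h1 (TS a) (TS b))).
  rewrite /g /gg {1 2 3 4 5}/fy {1 2 3 4 5}/fv {1}/fs /= !dotE.
  by rewrite (dotC (fy b) (fy a)) (dotC (fv b) (fv a)); lra.
have /cvg_ex[y py] : cvg (fy (p n) @[n --> \oo]).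
  apply: (minimizing_seq_cvg _ _ _ fy _ _ m_le _ gm) => a b.
  have [c gc] := mid a b; exists c.
  by have := dot_ge0 (fv a - fv b); rewrite -dot_norm; lra.
have /cvg_ex[v pv] : cvg (fv (p n) @[n --> \oo]).
  apply: (minimizing_seq_cvg _ _ _ fv _ _ m_le _ gm) => a b.
  have [c gc] := mid a b; exists c.
  by have := dot_ge0 (fy a - fy b); rewrite -dot_norm; lra.
(* This choice makes [gg y v s] equal to [m], and convergence of [g (p n)] makes it the limit of
   [fs (p n)]. *)
pose s := m - (dot y y + dot v v) / 2.
have cvg_sq (x : nat -> H) l :
    x n @[n --> \oo] --> l -> dot (x n) (x n) @[n --> \oo] --> dot l l.
  move=> /cvg_norm xl; rewrite dot_norm expr2.
  under eq_fun do rewrite dot_norm expr2.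
  exact: cvgM.
have ps : fs (p n) @[n --> \oo] --> s.
  have -> : (fun n => fs (p n)) = (fun n => g (p n) -
      (dot (fy (p n)) (fy (p n)) + dot (fv (p n)) (fv (p n))) * 2^-1).
    by apply/funext => n; rewrite /g /gg; ring.
  apply: cvgB => //; apply: cvgM; last exact: cvg_cst.
  by apply: cvgD; exact: cvg_sq.
have Smin : S y v s.
  move=> y' v' s' Gs.
  have : Q (fy (p n)) (fv (p n)) (fs (p n)) y' v' s' @[n --> \oo]
      --> Q y v s y' v' s'.
    rewrite /Q (dotC y' v); under eq_fun do rewrite (dotC y').
    apply: cvgB; last exact: cvg_dotl.
    apply: cvgB; last exact: cvg_dotl.
    by apply: cvgD => //; exact: cvg_cst.
  move=> /cvgr_to_ge; apply; near=> n; exact: TS Gs.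
have first_order x u : M x u ->
    0 <= dot x u - s + dot y (x - y) + dot v (u - v).
  (* [D] and [E] are the first and second derivatives at 0 of [gg] along the segment from
     [(y, v, s)] to [(x, u, dot x u)]. *)
  move=> Mxu; set D := (X in 0 <= X).
  set E := dot (x - y) (x - y) + dot (u - v) (u - v).
  have E0 : 0 <= E by rewrite addr_ge0 ?dot_ge0.
  have DE t : 0 <= t -> t <= 1 -> 0 <= t * (D + t * E / 2).
    move=> t0 t1; have St := Sconv t _ _ _ _ _ _ t0 t1 Smin (MS _ _ Mxu).
    have := m_le (mkT _ _ _ St).
    rewrite /g /gg /fy /fv /fs /= /D /E /s !dotE (dotC x y) (dotC u v); lra.
  rewrite leNgt; apply/negP => D_lt0.
  have DE0 : 0 < E - D by lra.
  (* If [D < 0], this step length lies in ]0, 1] and makes [D + t * E / 2] negative. *)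
  have t0 : 0 < - D / (E - D) by rewrite divr_gt0 // oppr_gt0.
  have t1 : - D / (E - D) <= 1 by rewrite ler_pdivrMr //; lra.
  have := DE _ (ltW t0) t1; rewrite pmulr_rge0 // leNgt => /negP; apply.
  have -> : D + - D / (E - D) * E / 2 = D * (E - 2 * D) / (2 * (E - D)).
    by field; rewrite gt_eqF.
  rewrite pmulr_llt0 ?invr_gt0 ?mulr_gt0 // nmulr_rlt0 //; lra.
have rel x u : M x u -> dot (y + v) (y + v) <= dot (x - - v) (u - - y).
  move=> /first_order; have := S_ge _ _ _ Smin.
  by rewrite !dotE (dotC x y) (dotC v y); lra.
have Mvy : M (- v) (- y).
  by apply: maxi => x u /rel; apply: le_trans; exact: dot_ge0.
have := rel _ _ Mvy; rewrite !subrr dot0l.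
move=> /dot_eq0/eqP; rewrite addr_eq0 => /eqP yv.
by exists y; rewrite -yv in Mvy.
Unshelve. all: by end_near. Qed.

(** Reduces identities between vectors to identities between reals, within reach of [ring] and
    [field]. *)
Lemma dot_inj u v : (forall w, dot u w = dot v w) -> u = v.
Proof.
move=> uv; apply/eqP; rewrite -subr_eq0; apply/eqP/dot_eq0.
by rewrite dotDl dotNl uv subrr.
Qed.

(** Boundedness of [f] bounds [dot w w / 2 - f w] from below. Its minimising sequences converge, and
    the first-order condition at the limit [l] reads [f w = dot l w]. *)
Lemma riesz (f : H -> R) (C : R) :
  (forall u v, f (u + v) = f u + f v) ->
  (forall c u, f (c *: u) = c * f u) ->
  (forall u, `|f u| <= C * `|u|) ->
  exists l, forall w, f w = dot l w.
Proof.
move=> fD fZ fC.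
pose g w := dot w w / 2 - f w.
have fN u : f (- u) = - f u by rewrite -scaleN1r fZ mulN1r.
have g_ge w : - C ^+ 2 / 2 <= g w.
  have := le_trans (ler_norm _) (fC w).
  by rewrite /g dot_norm; have := sqr_ge0 (`|w| - C); nra.
have [m [p [m_le gm]]] := ex_minimizing_seq _ g 0 _ g_ge.
have /cvg_ex[l pl] : cvg (p n @[n --> \oo]).
  apply: (minimizing_seq_cvg _ _ _ id _ _ m_le _ gm) => a b.
  exists (2^-1 *: (a + b)).
  rewrite /g -dot_norm fZ !fD !dotE (dotC b a); lra.
exists l => w.
have quad t : 0 <= t * (dot l w - f w) + t ^+ 2 * (dot w w / 2).
  have : g (p n) + (t * (dot (p n) w - f w) + t ^+ 2 * (dot w w / 2))
      @[n --> \oo] --> m + (t * (dot l w - f w) + t ^+ 2 * (dot w w / 2)).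
    apply: cvgD => //; apply: cvgD; last exact: cvg_cst.
    apply: cvgM; first exact: cvg_cst.
    by apply: cvgB; [exact: cvg_dotl | exact: cvg_cst].
  move=> /cvgr_to_ge/(_ _) h; rewrite -(lerD2l m) addr0; apply: h.
  near=> n; have := m_le (p n + t *: w).
  by rewrite /g fD fZ !dotE (dotC w (p n)); lra.
apply/eqP; rewrite eq_sym -subr_eq0.
set D := dot l w - f w in quad *.
have W := dot_ge0 w; have W1 : 0 < dot w w + 1 by lra.
(* The added 1 covers [w = 0]; at this [t] the quadratic is a negative multiple of [D ^+ 2]. *)
have := quad (- D / (dot w w + 1)).
have -> : - D / (dot w w + 1) * D + (- D / (dot w w + 1)) ^+ 2 * (dot w w / 2)
    = - (D ^+ 2 * ((dot w w + 2) / (2 * (dot w w + 1) ^+ 2))).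
  by field; rewrite gt_eqF.
rewrite oppr_ge0 pmulr_lle0; last first.
  by rewrite divr_gt0 ?mulr_gt0 ?exprn_gt0 //; lra.
by move=> D2; rewrite -sqrf_eq0 eq_le D2 sqr_ge0.
Unshelve. all: by end_near. Qed.

(** * Weak limits along ultrafilters and Opial's argument *)

Lemma bounded_ultra_cvg (U : set_system nat) (f : nat -> R) (C : R) :
  UltraFilter U -> (forall n, `|f n| <= C) -> exists r : R, f n @[n --> U] --> r.
Proof.
move=> UU fC.
have seg : fmap f U `[- C, C]%classic.
  by rewrite /fmap /=; apply: filterE => n /=; rewrite in_itv /= -ler_norml.
have [r [_ clr]] := segment_compact _ seg.
exists r => N Nr.
have [//|nN] := in_ultra_setVsetC (f @^-1` N) UU.
by have [s [/= ? ?]] := clr (~` N) N nN Nr.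
Qed.

(** Weak compactness of balls: the functionals [dot (x n)] converge pointwise along [U] by
    compactness of segments, the limit functional is linear with the same bound, and Riesz's theorem
    represents it. *)
Lemma ultra_weak_limit (U : set_system nat) (x : nat -> H) (C : R) :
  UltraFilter U -> (forall n, `|x n| <= C) ->
  exists l, forall w, dot (x n) w @[n --> U] --> dot l w.
Proof.
move=> UU xC.
have bound w n : `|dot (x n) w| <= C * `|w|.
  by apply: le_trans (CauchySchwarz _ _) _; exact: ler_wpM2r.
have [f fl] := choice (fun w => bounded_ultra_cvg _ _ _ UU (bound w)).
have [u v|c u|u|l fE] := riesz f C.
- apply: cvg_unique (fl (u + v)) _ => //.
  by rewrite /=; under eq_fun do rewrite dotDr; apply: cvgD; exact: fl.
- apply: cvg_unique (fl (c *: u)) _ => //.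
  by rewrite /=; under eq_fun do rewrite dotZr; apply: cvgM; [exact: cvg_cst | exact: fl].
- have := cvgr_to_le (cvg_norm (fl u)); apply.
  by apply: filterE => n; exact: bound.
- by exists l => w; rewrite -fE; exact: fl.
Qed.

(** If the preimage of a neighbourhood of [l] were not in [\oo], the trace of [\oo] on its
    complement would be proper and would extend to an ultrafilter contradicting the assumption. *)
Lemma cvg_ultra (f : nat -> R) (l : R) :
  (forall U, UltraFilter U -> \oo `<=` U -> f n @[n --> U] --> l) ->
  f n @[n --> \oo] --> l.
Proof.
move=> fU N Nl; apply: contrapT => notN.
pose F := within (~` (f @^-1` N)) \oo.
have FF : ProperFilter F.
  split; last exact: within_filter.
  rewrite /F /within /= => F0; apply: notN.
  change (nbhs \oo (f @^-1` N)); apply: filterS F0 => n nN.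
  by apply: contrapT => /nN.
have [U [UU FU]] := ultraFilterLemma FF.
have UN : U (f @^-1` N).
  by apply: (fU U UU _ N Nl) => P oP; apply: FU; apply: filterS oP => n Pn _.
have UnN : U (~` (f @^-1` N)) by apply: FU; exact: withinT.
by have [n [/= ? ?]] := filter_ex (filterI UN UnN).
Qed.

(* Cluster points are taken along ultrafilters, which avoids extracting weakly
   convergent subsequences in a non-separable space. *)
Lemma opial (x : nat -> H) (Z : set H) (C : R) :
  (forall n, `|x n| <= C) ->
  (forall p, Z p -> cvg (dot (x n - p) (x n - p) @[n --> \oo])) ->
  (forall U, UltraFilter U -> \oo `<=` U -> forall l,
     (forall w, dot (x n) w @[n --> U] --> dot l w) -> Z l) ->
  exists2 l, Z l & forall U, UltraFilter U -> \oo `<=` U ->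
    forall w, dot (x n) w @[n --> U] --> dot l w.
Proof.
move=> xC xZ Zlim.
have uniq U V l l' : UltraFilter U -> UltraFilter V ->
    \oo `<=` U -> \oo `<=` V ->
    (forall w, dot (x n) w @[n --> U] --> dot l w) ->
    (forall w, dot (x n) w @[n --> V] --> dot l' w) -> l = l'.
  move=> UU UV oU oV xl xl'.
  have /cvg_ex[r rP] := xZ _ (Zlim _ UU oU _ xl).
  have /cvg_ex[r' rP'] := xZ _ (Zlim _ UV oV _ xl').
  (* Subtracting the squared distances to [l] and [l'] leaves a term affine in [x n]. Hence
     [dot (x n) (l - l')] converges along [\oo], and its limits along [U] and [V] agree. *)
  pose s := (dot l l - dot l' l' - (r - r')) / 2.
  have key : dot (x n) (l - l') @[n --> \oo] --> s.
    have -> : (fun n => dot (x n) (l - l')) =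
        (fun n => (dot l l - dot l' l' -
           (dot (x n - l) (x n - l) - dot (x n - l') (x n - l'))) * 2^-1).
      apply/funext => n; rewrite !dotE (dotC l (x n)) (dotC l' (x n)); lra.
    rewrite /s; apply: cvgM; last exact: cvg_cst.
    by apply: cvgB; [exact: cvg_cst | exact: cvgB].
  have keyU : dot (x n) (l - l') @[n --> U] --> s.
    by apply: cvg_trans key => P /oU.
  have keyV : dot (x n) (l - l') @[n --> V] --> s.
    by apply: cvg_trans key => P /oV.
  have e1 := cvg_unique _ (xl _) keyU; have e2 := cvg_unique _ (xl' _) keyV.
  apply/eqP; rewrite -subr_eq0; apply/eqP/dot_eq0.
  by rewrite dotDl dotNl e1 // e2 // subrr.
have [U [UU oU]] := ultraFilterLemma (F := \oo) _.
have [l xl] := ultra_weak_limit _ _ _ UU xC.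
exists l; first exact: Zlim xl.
move=> V UV oV; have [l' xl'] := ultra_weak_limit _ _ _ UV xC.
by rewrite (uniq _ _ _ _ UU UV oU oV xl xl').
Qed.

Lemma cvg_dot_bounded (F : set_system nat) (w c : nat -> H) (C : R) :
  Filter F -> (forall n, `|c n| <= C) ->
  `|w n| @[n --> F] --> (0 : R) -> dot (w n) (c n) @[n --> F] --> (0 : R).
Proof.
move=> FF cC w0; apply/norm_cvg0P.
apply: (@squeeze_cvgr _ _ _ _ (fun=> 0) (fun n => `|w n| * C)).
- apply: filterE => n; rewrite normr_ge0 /=.
  by apply: le_trans (CauchySchwarz _ _) _; exact: ler_wpM2l.
- exact: cvg_cst.
- by rewrite -[X in _ --> X](mul0r C); apply: cvgM => //; exact: cvg_cst.
Qed.

(** * Monotone operators and their resolvents *)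

Lemma monotone_dot alpha A x u y v :
  alpha_monotone dot alpha A -> A x u -> A y v ->
  alpha * dot (x - y) (x - y) <= dot (x - y) (u - v).
Proof. by move=> mA Ax Ay; rewrite dot_norm; exact: mA. Qed.

(** Adjoining the single point [(y, v)] to the graph preserves [alpha]-monotonicity, so maximality
    forces the point to be there already. *)
Lemma maximal_mem alpha A y v :
  maximally_alpha_monotone dot alpha A ->
  (forall x u, A x u -> alpha * dot (x - y) (x - y) <= dot (x - y) (u - v)) ->
  A y v.
Proof.
move=> [mA maxA] rel; apply: contrapT => nAyv; apply: maxA.
exists (fun x u => A x u \/ (x, u) = (y, v)); split; last first.
  split=> [[x u] /= Axu|/(_ (y, v))]; first by left.
  by move=> sub; apply: nAyv; apply: sub; right.
move=> x u x' u' /= [Axu|[-> ->]] [Axu'|[-> ->]].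
- exact: mA.
- by rewrite -dot_norm; exact: rel.
- by have := rel _ _ Axu'; rewrite -dot_norm !dotE; lra.
- by rewrite !subrr dot0l normr0 expr0n mulr0.
Qed.

Section Resolvent.
Context {alpha gamma : R} {A : H -> set H}.
Context (maxA : maximally_alpha_monotone dot alpha A).
Context (gamma_gt0 : 0 < gamma) (strong : 0 < 1 + gamma * alpha).

Let gamma_neq0 : gamma != 0. Proof. by rewrite gt_eqF. Qed.

Lemma resolvent_opE z x :
  resolvent_op (scale_op gamma A) z x <-> A x (gamma^-1 *: (z - x)).
Proof.
split=> [[_ -> [_ [w Axw <-] <-]]|Ax].
  by rewrite addrC addKr scalerA mulVf // scale1r.
exists x => //; exists (z - x); last by rewrite addrC subrK.
by exists (gamma^-1 *: (z - x)) => //; rewrite scalerA divff // scale1r.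
Qed.

(** Strong monotonicity of [Id + gamma A]. It gives uniqueness of resolvent values and, later,
    boundedness of the shadow sequence. *)
Lemma resolvent_graph_dot z z' x x' :
  A x (gamma^-1 *: (z - x)) -> A x' (gamma^-1 *: (z' - x')) ->
  (1 + gamma * alpha) * dot (x - x') (x - x') <= dot (x - x') (z - z').
Proof.
move=> Ax Ax'; have := monotone_dot _ _ _ _ _ _ maxA.1 Ax Ax'.
rewrite -(ler_pM2l gamma_gt0).
have -> : gamma * dot (x - x') (gamma^-1 *: (z - x) - gamma^-1 *: (z' - x'))
    = dot (x - x') (z - z') - dot (x - x') (x - x').
  by rewrite !dotE; field.
by lra.
Qed.

Lemma resolvent_unique z x :
  A x (gamma^-1 *: (z - x)) -> resolvent (scale_op gamma A) z = x.
Proof.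
move=> Ax; apply: fun_of_rel_uniq; last exact/resolvent_opE.
move=> y y' /resolvent_opE Ay /resolvent_opE Ay'.
apply/eqP; rewrite -subr_eq0; apply/eqP/dot_eq0.
have := resolvent_graph_dot _ _ _ _ Ay Ay'.
rewrite subrr dot0r.
by rewrite pmulr_rle0.
Qed.

(** Subtracting [alpha Id] turns [A] into a maximally monotone operator. The map [f] rescales and
    translates it so that [- x = f x u] means [x + gamma *: u = z], and Minty's theorem then solves
    this equation. *)
Lemma resolvent_graph z : (exists x u, A x u) ->
  A (resolvent (scale_op gamma A) z)
    (gamma^-1 *: (z - resolvent (scale_op gamma A) z)).
Proof.
move=> [x0 [u0 A0]]; pose k := 1 + gamma * alpha.
have k_gt0 : 0 < k by [].
have k_neq0 : k != 0 by rewrite gt_eqF.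
pose f (x u : H) : H := k^-1 *: (gamma *: (u - alpha *: x) - z).
pose M (x v : H) := exists2 u, A x u & v = f x u.
apply/resolvent_opE; apply: (fun_of_relP id).
have fE x u y v : dot (x - y) (f x u - f y v) =
    gamma / k * (dot (x - y) (u - v) - alpha * dot (x - y) (x - y)).
  by rewrite /f !dotE (dotC y x); field.
have gk : 0 < gamma / k by rewrite divr_gt0.
have [x [u Axu xE]] : exists x, M x (- x).
  apply: minty.
  - by exists x0, (f x0 u0), u0.
  - move=> x _ y _ [u Axu ->] [v Ayv ->].
    by rewrite fE pmulr_rge0 // subr_ge0; exact: monotone_dot maxA.1 _ _.
  (* The witness solves [v = f y u] for [u]. *)
  - move=> y v rel; exists (gamma^-1 *: (k *: v + z) + alpha *: y); last first.
      apply: dot_inj => w; rewrite /f !dotE; field.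
      by rewrite gamma_neq0 k_neq0.
    apply: maximal_mem maxA _ => x u Axu.
    have := rel _ _ (ex_intro2 _ _ _ Axu erefl).
    set v' := (X in _ -> _ <= dot _ (_ - X)).
    have -> : v = f y v'.
      apply: dot_inj => w; rewrite /f /v' !dotE; field.
      by rewrite gamma_neq0 k_neq0.
    by rewrite fE pmulr_rge0 // subr_ge0.
exists x; apply/resolvent_opE.
suff -> : gamma^-1 *: (z - x) = u by [].
apply: dot_inj => w.
have : dot (- x) w = dot (f x u) w by rewrite -xE.
rewrite /f !dotE => E.
have {}E : k * - dot x w = gamma * (dot u w - alpha * dot x w) - dot z w.
  by rewrite E; field.
apply: (mulfI gamma_neq0); rewrite mulrA divff // mul1r.
by move: E; rewrite /k; lra.
Qed.

End Resolvent.

(* The constant comes from completing the square in [e] when alpha + beta > 0;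
   when alpha + beta = 0 the cross term vanishes and c = mu / 2. *)
Lemma cocoercive_constant (alpha beta gamma delta lambda mu kappa : R) :
  0 <= alpha + beta -> 0 < gamma -> 0 < delta ->
  (lambda - 1) * (mu - 1) = 1 -> delta = (lambda - 1) * gamma ->
  (alpha + beta = 0 -> delta * (1 + 2 * gamma * alpha) = gamma) ->
  0 < kappa -> kappa < kappa_bar alpha beta gamma delta ->
  exists2 c, kappa * mu < 2 * c & forall e w : H,
    c * dot w w <= (gamma / delta + gamma * beta) * dot w w
      + (1 - gamma / delta - 2 * gamma * beta) * dot w e
      + gamma * (alpha + beta) * dot e e.
Proof.
move=> ab0 g0 d0 lm dg case0 k0.
have d_neq0 : delta != 0 by rewrite gt_eqF.
(* [lambda - 1] equals [delta / gamma], and [mu - 1] is its inverse. *)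
have muE : mu = (gamma + delta) / delta.
  have l1 : lambda - 1 != 0.
    by apply/eqP => l0; move/eqP: lm; rewrite l0 mul0r eq_sym oner_eq0.
  apply: (mulfI l1); rewrite dg.
  have -> : (lambda - 1) * mu = (lambda - 1) * (mu - 1) + (lambda - 1) by ring.
  rewrite lm; field.
  by rewrite gt_eqF.
rewrite /kappa_bar; case: ifP => [/eqP ab k1|/negbT ab kb].
  have gd := case0 ab.
  have bE : beta = - alpha by lra.
  have rE : gamma / delta = 1 + 2 * gamma * alpha.
    by rewrite -{1}gd mulrAC divff // mul1r.
  have mu2 : mu = 2 * (1 + gamma * alpha).
    by rewrite muE mulrDl divff // rE; ring.
  exists (1 + gamma * alpha); last by move=> e w; rewrite rE bE; lra.
  have mu0 : 0 < mu by rewrite muE divr_gt0 // addr_gt0.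
  by rewrite -mu2 gtr_pMl.
have s0 : 0 < alpha + beta by rewrite lt_neqAle eq_sym ab.
set r := 1 - gamma / delta - 2 * gamma * beta.
set s := gamma * (alpha + beta); have s_gt0 : 0 < s by exact: mulr_gt0.
have s_neq0 : s != 0 by rewrite gt_eqF.
exists (gamma / delta + gamma * beta - r ^+ 2 / (4 * s)).
  have gd0 : 0 < gamma + delta by rewrite addr_gt0.
  rewrite -ltr_pdivlMr; last by rewrite muE divr_gt0.
  (* [kappa_bar] is exactly [2 * c / mu]. *)
  suff -> : 2 * (gamma / delta + gamma * beta - r ^+ 2 / (4 * s)) / mu =
      (4 * gamma * delta * (1 + gamma * alpha) * (1 + delta * beta)
        - (gamma + delta) ^+ 2)
      / (2 * gamma * delta * (gamma + delta) * (alpha + beta)) by [].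
  rewrite muE /s /r; field.
  by rewrite !gt_eqF.
move=> e w; have := mulr_ge0 (ltW s_gt0) (dot_ge0 (e + (r / (2 * s)) *: w)).
rewrite !dotE (dotC e w) => sq_ge0; rewrite -subr_ge0; apply: le_trans sq_ge0 _.
rewrite le_eqVlt; apply/orP; left; apply/eqP; field.
by rewrite s_neq0.
Qed.

(** When [alpha + beta = 0], both [2 delta (1 + gamma alpha)] and [2 gamma (1 + delta beta)] equal
    [gamma + delta]. Otherwise the two factors have a positive product, and both being negative
    would make [alpha] and [beta] negative. *)
Lemma resolvent_constants_gt0 (alpha beta gamma delta : R) :
  0 <= alpha + beta -> 0 < gamma -> 0 < delta ->
  (alpha + beta = 0 -> delta * (1 + 2 * gamma * alpha) = gamma) ->
  (0 < alpha + beta -> (gamma + delta) ^+ 2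
      < 4 * gamma * delta * (1 + gamma * alpha) * (1 + delta * beta)) ->
  0 < 1 + gamma * alpha /\ 0 < 1 + delta * beta.
Proof.
move=> ab0 g0 d0 case0 case1.
have [ab|ab] := eqVneq (alpha + beta) 0.
  have gd := case0 ab; have bE : beta = - alpha by lra.
  split.
    by rewrite -(pmulr_rgt0 _ d0); nra.
  by rewrite -(pmulr_rgt0 _ g0) bE; nra.
have s0 : 0 < alpha + beta by rewrite lt_neqAle eq_sym ab.
have lt := case1 s0.
have prod : 0 < (1 + gamma * alpha) * (1 + delta * beta).
  rewrite -(pmulr_rgt0 _ (mulr_gt0 g0 d0)).
  have := sqr_ge0 (gamma + delta); nra.
have [ha|ha] := ltP 0 (1 + gamma * alpha).
  by move: prod; rewrite pmulr_rgt0.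
have hb : 1 + delta * beta < 0.
  rewrite ltNge; apply/negP => hb.
  by have := mulr_le0_ge0 ha hb; rewrite leNgt prod.
have a0 : alpha < 0 by rewrite -(pmulr_rlt0 _ g0); lra.
have b0 : beta < 0 by rewrite -(pmulr_rlt0 _ d0); lra.
lra.
Qed.

(* Summing the two monotonicity inequalities makes the nonlinear terms cancel
   up to vanishing ones.  In the limit the inequality splits into a part over
   [gra A] and a part over [gra B]; by maximality each has infimum at most 0. *)
Lemma demiclosed_sum (F : set_system nat) (alpha beta delta C : R)
    (A B : H -> set H) (y a w : nat -> H) (ly la : H) :
  ProperFilter F -> 0 <= alpha + beta ->
  maximally_alpha_monotone dot alpha A -> maximally_alpha_monotone dot beta B ->
  (forall n, A (y n) (a n)) ->
  (forall n, B (y n - w n) (- a n + delta^-1 *: w n)) ->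
  (forall n, `|y n| <= C) -> (forall n, `|a n| <= C) ->
  (forall n, `|w n| <= C) ->
  `|w n| @[n --> F] --> (0 : R) ->
  (forall v, dot (y n) v @[n --> F] --> dot ly v) ->
  (forall v, dot (a n) v @[n --> F] --> dot la v) ->
  A ly la /\ B ly (- la).
Proof.
move=> FF ab0 maxA maxB Ay Bz yC aC wC w0 yl al.
have wl v : dot (w n) v @[n --> F] --> (0 : R).
  exact: (cvg_dot_bounded _ _ (fun=> v) `|v|).
have wy := cvg_dot_bounded _ _ _ _ _ yC w0.
have wa := cvg_dot_bounded _ _ _ _ _ aC w0.
have ww := cvg_dot_bounded _ _ _ _ _ wC w0.
pose gapA p u := dot (p - ly) (u - la) - alpha * dot (p - ly) (p - ly).
pose gapB q v := dot (q - ly) (v + la) - beta * dot (q - ly) (q - ly).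
have gap_ge0 p u q v : A p u -> B q v -> 0 <= gapA p u + gapB q v.
  move=> Apu Bqv.
  (* [h n] adds [(alpha + beta) |y n - ly|^2] to the two monotonicity gaps. This cancels the square
     of [y n], which weak convergence does not control; every remaining product of two sequences
     contains [w n]. *)
  pose k := (alpha + beta) * dot ly ly + dot p u - alpha * dot p p + dot q v
    - beta * dot q q.
  pose vy := - (2 * (alpha + beta)) *: ly - u + (2 * alpha) *: p - v
    + (2 * beta) *: q.
  pose vw := v - (delta^-1 + 2 * beta) *: q.
  pose h n : R := k + dot (y n) vy + dot (a n) (q - p) + dot (w n) vw
    + (delta^-1 + 2 * beta) * dot (w n) (y n) + dot (w n) (a n)
    - (delta^-1 + beta) * dot (w n) (w n).
  have h_ge0 n : 0 <= h n.
    have hA := monotone_dot _ _ _ _ _ _ maxA.1 (Ay n) Apu.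
    have hB := monotone_dot _ _ _ _ _ _ maxB.1 (Bz n) Bqv.
    have sq := mulr_ge0 ab0 (dot_ge0 (y n - ly)).
    move: hA hB sq; rewrite /h /k /vy /vw !dotE.
    rewrite (dotC ly (y n)) (dotC p (a n)) (dotC p (y n)) (dotC q (y n)).
    rewrite (dotC q (w n)) (dotC q (a n)) (dotC (y n) (w n)).
    lra.
  have hl : h n @[n --> F] --> k + dot ly vy + dot la (q - p) + 0
      + (delta^-1 + 2 * beta) * 0 + 0 - (delta^-1 + beta) * 0.
    apply: cvgB; last by apply: cvgM; [exact: cvg_cst | exact: ww].
    apply: cvgD; last exact: wa.
    apply: cvgD; last by apply: cvgM; [exact: cvg_cst | exact: wy].
    apply: cvgD; last exact: wl.
    apply: cvgD; last exact: al.
    by apply: cvgD; [exact: cvg_cst | exact: yl].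
  apply: le_trans (cvgr_to_ge hl _) _; first exact: filterE.
  rewrite /gapA /gapB /k /vy /vw !dotE.
  rewrite (dotC p ly) (dotC q ly) (dotC p la) (dotC q la) (dotC ly la).
  by lra.
(* A positive lower bound [K] would put [(ly, v)] in the graph of [D], where the gap is 0. It is
   applied with [K] the opposite of the other operator's gap at a fixed point. *)
have inf_le0 (K : R) (alpha' : R) D v : maximally_alpha_monotone dot alpha' D ->
    (forall p u, D p u ->
       K <= dot (p - ly) (u - v) - alpha' * dot (p - ly) (p - ly)) -> K <= 0.
  move=> maxD DK; rewrite leNgt; apply/negP => K_gt0.
  have /DK : D ly v.
    apply: maximal_mem maxD _ => p u /DK; lra.
  by rewrite !subrr dot0l; lra.
split; [apply: maximal_mem maxA _ => p u Apu |
  apply: maximal_mem maxB _ => q v Bqv].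
  rewrite -subr_ge0 -[X in 0 <= X]opprK oppr_ge0.
  apply: (inf_le0 _ _ _ (- la) maxB) => q v Bqv.
  by have := gap_ge0 _ _ _ _ Apu Bqv; rewrite /gapA /gapB opprK; lra.
rewrite -subr_ge0 -[X in 0 <= X]opprK oppr_ge0.
apply: (inf_le0 _ _ _ la maxA) => p u Apu.
by have := gap_ge0 _ _ _ _ Apu Bqv; rewrite /gapA /gapB opprK; lra.
Qed.

End InnerProduct.

(* MathComp-Analysis.  A real Hilbert space is a complete normed space H with
   an inner product dot inducing its norm. *)
Theorem theorem4p1 (R : realType) (H : completeNormedModType R)
  (dot : {dot H for idfun}) (dot_norm : forall z : H, dot z z = `|z| ^+ 2)
  (alpha beta : R) (alpha_beta : 0 <= alpha + beta)
  (A B : H -> set H)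
  (maxA : maximally_alpha_monotone dot alpha A)
  (maxB : maximally_alpha_monotone dot beta B)
  (zerAB : zer (add_op A B) !=set0)
  (gamma delta lambda mu : R)
  (gamma_gt0 : 0 < gamma) (delta_gt0 : 0 < delta)
  (lambda_gt0 : 0 < lambda) (mu_gt0 : 0 < mu)
  (lambda_mu : (lambda - 1) * (mu - 1) = 1)
  (delta_gamma : delta = (lambda - 1) * gamma)
  (case_eq0 : alpha + beta = 0 -> delta * (1 + 2 * gamma * alpha) = gamma)
  (case_gt0 : 0 < alpha + beta ->
    (gamma + delta) ^+ 2
      < 4 * gamma * delta * (1 + gamma * alpha) * (1 + delta * beta))
  (kappa : R) (kappa_gt0 : 0 < kappa)
  (kappa_lt : kappa < kappa_bar alpha beta gamma delta)
  (x0 : H) (x : nat -> H) (x_init : x 0%N = x0)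
  (x_step : forall k : nat,
    x k.+1 = aDR A B gamma delta lambda mu kappa (x k)) :
  exists xstar : H,
    [/\ Fix (sv_op (aDR A B gamma delta lambda mu kappa)) xstar,
        weak_cvg dot x xstar,
        weak_cvg dot (fun k => resolvent (scale_op gamma A) (x k))
          (resolvent (scale_op gamma A) xstar)
      & zer (add_op A B) (resolvent (scale_op gamma A) xstar)].
Proof.
have [kA kB] := resolvent_constants_gt0 alpha beta gamma delta alpha_beta
  gamma_gt0 delta_gt0 case_eq0 case_gt0.
have [c c_gt cP] := cocoercive_constant dot dot_norm alpha beta gamma delta
  lambda mu kappa alpha_beta gamma_gt0 delta_gt0 lambda_mu delta_gamma case_eq0
  kappa_gt0 kappa_lt.
have gamma_neq0 : gamma != 0 by rewrite gt_eqF.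
have delta_neq0 : delta != 0 by rewrite gt_eqF.
have [ybar [abar Abar [bbar Bbar abbar]]] := zerAB.
pose dE := dotE dot.

(* The iteration in terms of [W] *)
pose J1 := resolvent (scale_op gamma A); pose J2 := resolvent (scale_op delta B).
pose R1 := relax lambda J1.
pose W u := J1 u - J2 (R1 u).
pose a u := gamma^-1 *: (u - J1 u).
have AJ u : A (J1 u) (a u).
  by apply: (resolvent_graph dot dot_norm maxA gamma_gt0 kA); exists ybar,
    abar.
have BJ u : B (J1 u - W u) (- a u + delta^-1 *: W u).
  have BJ2 : B (J2 (R1 u)) (delta^-1 *: (R1 u - J2 (R1 u))).
    by apply: (resolvent_graph dot dot_norm maxB delta_gt0 kB); exists ybar,
      bbar.
  have -> : J1 u - W u = J2 (R1 u) by rewrite /W opprB addrC subrK.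
  (* As [delta = (lambda - 1) * gamma], the relaxation gives [R1 u = J1 u - delta *: a u]. *)
  suff -> : - a u + delta^-1 *: W u = delta^-1 *: (R1 u - J2 (R1 u)) by [].
  apply: (dot_inj dot dot_norm) => w; rewrite /a /W {2}/R1 /relax !dE.
  move: delta_neq0; rewrite delta_gamma mulf_eq0 negb_or => /andP[l1 _].
  by field; rewrite gamma_neq0.
pose T := aDR A B gamma delta lambda mu kappa.
(* In [R2 (R1 u)] the coefficient of [u] is [(1 - mu) * (1 - lambda) = 1], and that of [J1 u] is
   [(1 - mu) * lambda = - mu]. *)
have TE u : T u = u - (kappa * mu) *: W u.
  apply: (dot_inj dot dot_norm) => w.
  rewrite /T /aDR /= -/J1 -/J2 -/R1 /W {1}/relax /= {1}/relax {1}/R1 /relax !dE.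
  have lmE : lambda * mu = lambda + mu by move: lambda_mu; lra.
  by ring: lmE.
pose Z : set H :=
  [set p | exists y b, [/\ A y b, B y (- b) & p = y + gamma *: b]].
have ZJ y b : A y b -> J1 (y + gamma *: b) = y.
  move=> Ayb; apply: (resolvent_unique dot dot_norm maxA gamma_gt0 kA).
  by rewrite addrAC subrr add0r scalerA mulVf // scale1r.
have ZW y b : A y b -> B y (- b) -> W (y + gamma *: b) = 0.
  move=> Ayb Byb; rewrite /W ZJ //; apply/eqP; rewrite subr_eq0 eq_sym; apply/eqP.
  apply: (resolvent_unique dot dot_norm maxB delta_gt0 kB).
  rewrite /R1 /relax ZJ //.
  suff -> : delta^-1 *: ((1 - lambda) *: (y + gamma *: b) + lambda *: y - y) = - b.
    by [].
  apply: (dot_inj dot dot_norm) => w; rewrite !dE delta_gamma.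
  move: delta_neq0; rewrite delta_gamma mulf_eq0 negb_or => /andP[l1 _].
  by field; rewrite gamma_neq0.

(* Fejér monotonicity and vanishing of [W (x n)] *)
have fejer p u : Z p -> dot (T u - p) (T u - p) <=
    dot (u - p) (u - p) - kappa * mu * (2 * c - kappa * mu) * dot (W u) (W u).
  move=> [y [b [Ayb Byb ->]]].
  set p' := y + gamma *: b.
  have hA := monotone_dot dot dot_norm _ _ _ _ _ _ maxA.1 (AJ u) Ayb.
  have hB := monotone_dot dot dot_norm _ _ _ _ _ _ maxB.1 (BJ u) Byb.
  pose e := J1 u - y; pose w := W u; pose d := u - p'.
  (* [gamma] times the sum of [hA] and [hB] bounds [dot w d] below by the quadratic form in [e] and
     [w] that [cP] estimates. *)
  have key : c * dot w w <= dot w d.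
    apply: le_trans (cP e w) _.
    have aE : a u - b = gamma^-1 *: (d - e).
      apply: (dot_inj dot dot_norm) => v; rewrite /a /d /e /p' !dE.
      by field.
    have bE : - a u + delta^-1 *: W u - - b = - (a u - b) + delta^-1 *: w.
      by rewrite opprB opprK addrAC (addrC b).
    have eE : J1 u - W u - y = e - w by rewrite /e /w addrAC.
    move: hA hB; rewrite bE eE aE -/e => hA hB; clearbody e w d.
    have := lerD (ler_wpM2l (ltW gamma_gt0) hA) (ler_wpM2l (ltW gamma_gt0) hB).
    have -> : gamma * dot e (gamma^-1 *: (d - e)) = dot e (d - e).
      by rewrite (dotZr dot) mulrA divff // mul1r.
    have -> : gamma * dot (e - w) (- (gamma^-1 *: (d - e)) + delta^-1 *: w) =
        - dot (e - w) (d - e) + gamma / delta * dot (e - w) w.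
      by rewrite !dE; field; rewrite gamma_neq0 delta_neq0.
    by rewrite !dE (dotC dot e w); lra.
  have km : 0 < kappa * mu by exact: mulr_gt0.
  rewrite TE -/w.
  have -> : u - (kappa * mu) *: w - p' = d - (kappa * mu) *: w by rewrite addrAC.
  have := ler_wpM2l (ltW km) key; rewrite -/d; clearbody w d.
  by rewrite !dE (dotC dot d w); lra.
pose eps := kappa * mu * (2 * c - kappa * mu).
have eps_gt0 : 0 < eps by rewrite !mulr_gt0 // subr_gt0.
pose sqd p n := dot (x n - p) (x n - p).
have sqd_step p n : Z p -> eps * dot (W (x n)) (W (x n)) <= sqd p n - sqd p n.+1.
  by move=> Zp; have := fejer p (x n) Zp; rewrite /sqd x_step -/T /eps; lra.
have sqd_noninc p : Z p -> {homo sqd p : n m / (n <= m)%N >-> m <= n}.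
  move=> Zp; apply/nonincreasing_seqP => n; rewrite -subr_ge0.
  by apply: le_trans (sqd_step p n Zp); rewrite mulr_ge0 ?(ltW eps_gt0) ?dot_ge0.
have sqd_cvg p : Z p -> cvg (sqd p n @[n --> \oo]).
  move=> Zp; apply: nonincreasing_is_cvgn; first exact: sqd_noninc.
  by exists 0 => _ [n _ <-]; exact: dot_ge0.
pose pbar := ybar + gamma *: abar.
have Bbar' : B ybar (- abar).
  by rewrite (_ : - abar = bbar) //; apply/eqP; rewrite eq_sym -addr_eq0 addrC abbar.
have Zbar : Z pbar by exists ybar, abar.
have W_cvg0 : `|W (x n)| @[n --> \oo] --> (0 : R).
  have /cvg_ex[l sl] := sqd_cvg _ Zbar.
  have WW : dot (W (x n)) (W (x n)) @[n --> \oo] --> (0 : R).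
    apply: (@squeeze_cvgr _ _ _ _ (fun=> 0)
      (fun n => (sqd pbar n - sqd pbar n.+1) / eps)).
    - apply: filterE => n; rewrite dot_ge0 //= ler_pdivlMr // mulrC.
      exact: sqd_step.
    - exact: cvg_cst.
    - rewrite -(mul0r eps^-1) -(subrr l); apply: cvgM; last exact: cvg_cst.
      by apply: cvgB => //; rewrite (cvg_shiftS (sqd pbar)).
  apply/cvgrPdist_lt => e e_gt0; have e2 : 0 < e ^+ 2 by exact: exprn_gt0.
  have /(_ _ e2) := cvgr_lt _ WW (e ^+ 2); apply: filterS => n.
  rewrite dot_norm sub0r normrN normr_id.
  by rewrite ltr_pXn2r ?nnegrE ?normr_ge0 // ltW.

(* Uniform bounds on the sequences *)
pose D := sqd pbar 0%N.
have D_ge0 : 0 <= D by exact: dot_ge0.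
have sqd_le n : sqd pbar n <= D by apply: sqd_noninc.
have norm_le_sq (r : R) : r <= 1 + r ^+ 2 by have := sqr_ge0 (r - 1); nra.
have d_le n : `|x n - pbar| <= 1 + D.
  apply: le_trans (norm_le_sq _) _; rewrite -dot_norm lerD2l; exact: sqd_le.
have x_le n : `|x n| <= `|pbar| + (1 + D).
  by have := ler_normD (x n - pbar) pbar; rewrite subrK; have := d_le n; lra.
have W_le n : `|W (x n)| <= 1 + D / eps.
  apply: le_trans (norm_le_sq _) _; rewrite -dot_norm lerD2l ler_pdivlMr //.
  rewrite mulrC; have := sqd_step _ n Zbar; have := sqd_le n.
  by have := dot_ge0 dot dot_norm (x n.+1 - pbar); rewrite -/(sqd pbar n.+1); lra.
(* [ybar] is the resolvent value at [pbar], so strong monotonicity and Cauchy-Schwarz bound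
   [(1 + gamma * alpha) |J1 (x n) - ybar|] by [|x n - pbar|]. *)
have J_le n : `|J1 (x n)| <= `|ybar| + (1 + D) / (1 + gamma * alpha).
  have := ler_normD (J1 (x n) - ybar) ybar; rewrite subrK addrC => /le_trans; apply.
  rewrite lerD2l.
  rewrite ler_pdivlMr //; apply: le_trans (d_le n).
  have [->|e0] := eqVneq (J1 (x n) - ybar) 0; first by rewrite normr0 mul0r.
  have e_gt0 : 0 < `|J1 (x n) - ybar| by rewrite normr_gt0.
  rewrite -(ler_pM2l e_gt0) mulrA -expr2 -dot_norm mulrC.
  apply: le_trans (CauchySchwarz dot dot_norm _ _); apply: le_trans (ler_norm _).
  apply: (resolvent_graph_dot dot dot_norm maxA gamma_gt0); first exact: AJ.
  by rewrite /pbar addrC addKr scalerA mulVf // scale1r.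
pose Cx := `|pbar| + (1 + D); pose Cy := `|ybar| + (1 + D) / (1 + gamma * alpha).
pose Ca := gamma^-1 * (Cx + Cy); pose Cw := 1 + D / eps.
have a_le n : `|a (x n)| <= Ca.
  rewrite normrZ gtr0_norm ?invr_gt0 // ler_pM2l ?invr_gt0 //.
  by rewrite (le_trans (ler_normB _ _)) // lerD.
pose C := Cy + Ca + Cw.
have Cy_ge0 : 0 <= Cy by exact: le_trans (J_le 0%N).
have Ca_ge0 : 0 <= Ca by exact: le_trans (a_le 0%N).
have Cw_ge0 : 0 <= Cw by exact: le_trans (W_le 0%N).

(* Weak cluster points and conclusion *)
have clusters U l : UltraFilter U -> \oo `<=` U ->
    (forall v, dot (x n) v @[n --> U] --> dot l v) ->
    exists ly, [/\ A ly (gamma^-1 *: (l - ly)), B ly (- (gamma^-1 *: (l - ly)))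
      & forall v, dot (J1 (x n)) v @[n --> U] --> dot ly v].
  move=> UU oU xl.
  have [ly yl] := ultra_weak_limit dot dot_norm U (fun n => J1 (x n)) Cy UU J_le.
  exists ly.
  have [] // := demiclosed_sum dot dot_norm U alpha beta delta C A B
    (fun n => J1 (x n)) (fun n => a (x n)) (fun n => W (x n)) ly
    (gamma^-1 *: (l - ly)) _ alpha_beta maxA maxB (fun n => AJ (x n))
    (fun n => BJ (x n)).
  - by move=> n; apply: le_trans (J_le n) _; rewrite /C -addrA lerDl addr_ge0.
  - by move=> n; apply: le_trans (a_le n) _; rewrite /C addrAC lerDr addr_ge0.
  - by move=> n; apply: le_trans (W_le n) _; rewrite /C lerDr addr_ge0.
  - by apply: cvg_trans W_cvg0 => P /oU.
  - move=> v; rewrite !dE.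
    under eq_fun do rewrite /a dotZl dotDl dotNl.
    by apply: cvgM; [exact: cvg_cst | apply: cvgB; [exact: xl | exact: yl]].
have [xs [y [b [Ayb Byb xsE]]] xsU] : exists2 l, Z l & forall U,
    UltraFilter U -> \oo `<=` U -> forall v, dot (x n) v @[n --> U] --> dot l v.
  apply: (opial dot dot_norm x Z _ x_le sqd_cvg) => U UU oU l xl.
  have [ly [Al Bl _]] := clusters U l UU oU xl.
  exists ly, (gamma^-1 *: (l - ly)); split => //.
  by rewrite scalerA divff // scale1r addrC subrK.
exists xs; split.
- by rewrite /Fix /sv_op /= -/T TE xsE ZW // scaler0 subr0.
- by move=> v; apply: cvg_ultra => U UU oU; exact: xsU.
- move=> v; apply: cvg_ultra => U UU oU.
  (* The shadow limit along [U] is a resolvent value at [xs]; uniqueness makes it the same for every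
     [U]. *)
  have [ly [Al _ yl]] := clusters U xs UU oU (xsU U UU oU).
  have -> : resolvent (scale_op gamma A) xs = ly.
    exact: (resolvent_unique dot dot_norm maxA gamma_gt0 kA).
  exact: yl.
- rewrite -/J1 xsE ZJ //; exists b => //; exists (- b) => //.
  by rewrite subrr.
Qed.
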